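(* Let $(G,w)$ and $(G',w')$ be matrix-weighted graphs. If $(G,w)\sim(G',w')$, i.e. if they are connected by a finite sequence of elementary transformations of matrix-weighted graphs, then $\zeta_G(w)=\zeta_{G'}(w')$.
   Context: **Matrix-weighted graphs.** A graph $G=(V(G),E(G))$ is a connected, finite, directed graph, possibly with multiple edges and loops; an edge $e$ from $a$ to $b$ has $o(e)=a$, $t(e)=b$. A matrix-weight on $G$ consists of a positive integer $a_v$ for each vertex $v$ and, for each edge $e$ from $v$ to $v'$, an $a_v\times a_{v'}$ matrix $w(e)$ over $\mathbb{C}[t^{\pm1}]$. The pair $(G,w)$ is called a matrix-weighted graph. **Zeta function.** A cycle of length $n$ is a sequence of edges $C=(e_1,\dots,e_n)$ with $t(e_i)=o(e_{i+1})$ for $1\le i\le n-1$ and $t(e_n)=o(e_1)$. Two cycles are equivalent if they differ by a cyclic shift of indices. A cycle is prime if it is not a power (an $r$-fold repetition, $r\geq 2$) of a strictly shorter cycle. Put $w(C)=w(e_1)\cdots w(e_n)$. The matrix-weighted zeta function is $$\zeta_G(w)=\prod_{[C]}\det(I-w(C))^{-1},$$ the product over all equivalence classes of prime cycles. This is a formal product; it is identified (Watanabe–Fukumizu) with $\det(I-A(G,w))^{-1}$, where $A(G,w)$ is the block matrix whose $(v,v')$ block is the sum of the weights of all edges from $v$ to $v'$ ($0$ if there are none). Thus equality of zeta functions is understood as equality of the corresponding determinants $\det(I-A)$. **Elementary transformations of a matrix-weighted graph.** These are the following local modifications, their inverses, and the modifications obtained from them by reversing the direction of all edges involved (with products of weights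 taken in the order in which the edges are then traversed): 1. (change of basis) For a vertex $O$ and an invertible $a_O\times a_O$ matrix $P$ over $\mathbb{C}[t^{\pm1}]$: replace the weight $w_i$ of each edge ending at $O$ by $w_iP^{-1}$ and the weight $u_j$ of each edge starting at $O$ by $Pu_j$ (a loop $u$ at $O$ becomes $PuP^{-1}$). 2. (null edge) Add or delete an edge (in either direction) of weight $0$ between two vertices. 3. (summing weights) Replace parallel edges from $O_1$ to $O_2$ with weights $w_1,\dots,w_n$ by a single edge from $O_1$ to $O_2$ with weight $\sum_i w_i$. 4. (source/sink eliminating) Delete a vertex having no incoming edges (a source), together with all its outgoing edges; similarly for a sink. 5. (hub vertex resolution) Let $v_1\ne v_2$, let $e$ be an edge from $v_1$ to $v_2$ of weight $u$, and let $f_1,\dots,f_n$ ($n\ge1$) be all edges starting at $v_2$, with weights $w_1,\dots,w_n$. Delete $e$ and add, for each $i$, an edge from $v_1$ to $t(f_i)$ of weight $uw_i$; all other edges, including the $f_i$, are kept. Write $(G,w)\sim(G',w')$ if the two matrix-weighted graphs are connected by a finite sequence of elementary transformations. *)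

(* Defs.v *)
From Stdlib Require Import Relation_Operators.
From HB Require Import structures.
From mathcomp Require Import all_boot all_order all_algebra fraction.
From mathcomp Require Import boolp reals.
From mathcomp Require Import complex.

Set Implicit Arguments.
Unset Strict Implicit.
Unset Printing Implicit Defensive.

Import GRing.Theory.
Local Open Scope ring_scope.

Local Notation "p %:F" := (tofrac p) : ring_scope.

Section Laurent.
Variable K : fieldType.

(* K[t^{+-1}] is the subring of K(t) of the fractions p / t^n. *)
Definition is_laurent : {pred {fraction {poly K}}} :=
  fun x => `[< exists (p : {poly K}) (n : nat), x = p%:F / 'X%:F ^+ n >].

Lemma is_laurent_subring : subring_closed is_laurent.
Proof.
have X0 n : ('X : {poly K})%:F ^+ n != 0.
  by rewrite expf_neq0 // tofrac_eq0 polyX_eq0.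
split=> [|x y|x y].
- by apply/asboolP; exists 1, 0%N; rewrite expr0 divr1 tofrac1.
- move=> /asboolP[p [n ->]] /asboolP[q [m ->]]; apply/asboolP.
  exists (p * 'X ^+ m - q * 'X ^+ n), (n + m)%N.
  by rewrite tofracB !tofracM !tofracXn exprD -mulNr addf_div // mulNr.
- move=> /asboolP[p [n ->]] /asboolP[q [m ->]]; apply/asboolP.
  by exists (p * q), (n + m)%N; rewrite tofracM exprD mulf_div.
Qed.

HB.instance Definition _ :=
  GRing.isSubringClosed.Build {fraction {poly K}} is_laurent is_laurent_subring.

Record laurent : predArgType :=
  Laurent { laurent_val :> {fraction {poly K}}; _ : laurent_val \in is_laurent }.

HB.instance Definition _ := [isSub for laurent_val].
HB.instance Definition _ := [Choice of laurent by <:].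
HB.instance Definition _ := [SubChoice_isSubComNzRing of laurent by <:].

End Laurent.

Section Graphs.
Variable L : comNzRingType.

Record mwdigraph := MWDigraph {
  vert : finType;
  edge : finType;
  src : edge -> vert;
  tgt : edge -> vert;
  dim : vert -> nat;
  wgt : forall e : edge, 'M[L]_(dim (src e), dim (tgt e)) }.

(* Connectedness ignores the orientation of the edges. *)
Definition connected_digraph (G : mwdigraph) : Prop :=
  (0 < #|vert G|)%N /\
  forall x y : vert G,
    connect (fun u v => [exists e : edge G,
      ((src e == u) && (tgt e == v)) || ((src e == v) && (tgt e == u))]) x y.

Record mwgraph := MWGraph {
  mw_digraph :> mwdigraph;
  dim_gt0 : forall v : vert mw_digraph, (0 < dim v)%N;
  mw_connected : connected_digraph mw_digraph }.

(* [wgt_at x y e] is the weight of e, retyped, if e goes from x to y, and 0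
   otherwise. *)
Definition wgt_at (G : mwdigraph) (x y : vert G) (e : edge G) :
    'M[L]_(dim x, dim y) :=
  match src e =P x, tgt e =P y with
  | ReflectT ex, ReflectT ey => castmx (congr1 _ ex, congr1 _ ey) (wgt e)
  | _, _ => 0
  end.

Definition adjacency_block (G : mwdigraph) (x y : vert G) :
    'M[L]_(dim x, dim y) :=
  \sum_(e : edge G | (src e == x) && (tgt e == y)) wgt_at x y e.

Definition adjacency (G : mwdigraph) :
    'M[L]_(\sum_(i < #|vert G|) dim (enum_val i)) :=
  \mxblock_(i < #|vert G|, j < #|vert G|)
    adjacency_block (enum_val i) (enum_val j).

(* The reciprocal of the zeta function. It may vanish, so equality of zeta
   functions is expressed as equality of their reciprocals. *)
Definition zeta_inv (G : mwdigraph) : L := \det (1%:M - adjacency G).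

(* P at the vertex O, and the identity at all the other vertices. *)
Definition basis_at (G : mwdigraph) (O : vert G) (P : 'M[L]_(dim O))
    (v : vert G) : 'M[L]_(dim v) :=
  dfwith (fun u : vert G => 1%:M : 'M[L]_(dim u)) P v.

(* Q is meant to be the inverse of P. *)
Definition change_basis (G : mwdigraph) (O : vert G) (P Q : 'M[L]_(dim O)) :
    mwdigraph :=
  @MWDigraph (vert G) (edge G) (@src G) (@tgt G) (@dim G)
    (fun e => basis_at P (src e) *m wgt e *m basis_at Q (tgt e)).

Definition add_null_edge (G : mwdigraph) (x y : vert G) : mwdigraph :=
  @MWDigraph (vert G) (option (edge G))
    (fun e => if e is Some e' then src e' else x)
    (fun e => if e is Some e' then tgt e' else y)
    (@dim G)
    (fun e => match e with Some e' => wgt e' | None => 0 end).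

(* [None] is the edge from x to y that replaces the edges in S. *)
Definition sum_edges (G : mwdigraph) (x y : vert G) (S : {set edge G}) :
    mwdigraph :=
  @MWDigraph (vert G) (option {e : edge G | e \notin S})
    (fun e => if e is Some e' then src (val e') else x)
    (fun e => if e is Some e' then tgt (val e') else y)
    (@dim G)
    (fun e => match e with
              | Some e' => wgt (val e')
              | None => \sum_(e' in S) wgt_at x y e'
              end).

Definition delete_vertex (G : mwdigraph) (v : vert G) : mwdigraph :=
  @MWDigraph {u : vert G | u != v}
    {e : edge G | (src e != v) && (tgt e != v)}
    (fun e => exist _ (src (val e)) (proj1 (andP (valP e))))
    (fun e => exist _ (tgt (val e)) (proj2 (andP (valP e))))
    (fun u => dim (val u))
    (fun e => wgt (val e)).

(* [inr f] is the edge created by going along e and then along f. *)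
Definition resolve_hub_out (G : mwdigraph) (e : edge G) : mwdigraph :=
  @MWDigraph (vert G)
    ({e' : edge G | e' != e} + {f : edge G | src f == tgt e})%type
    (fun d => match d with inl e' => src (val e') | inr f => src e end)
    (fun d => match d with inl e' => tgt (val e') | inr f => tgt (val f) end)
    (@dim G)
    (fun d => match d with
              | inl e' => wgt (val e')
              | inr f => wgt e *m wgt_at (tgt e) (tgt (val f)) (val f)
              end).

(* [inr f] is the edge created by going along f and then along e. *)
Definition resolve_hub_in (G : mwdigraph) (e : edge G) : mwdigraph :=
  @MWDigraph (vert G)
    ({e' : edge G | e' != e} + {f : edge G | tgt f == src e})%type
    (fun d => match d with inl e' => src (val e') | inr f => src (val f) end)
    (fun d => match d with inl e' => tgt (val e') | inr f => tgt e end)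
    (@dim G)
    (fun d => match d with
              | inl e' => wgt (val e')
              | inr f => wgt_at (src (val f)) (src e) (val f) *m wgt e
              end).

(* Reversing the edges in the first three constructors gives instances of the
   same constructors. *)
Inductive elementary : mwdigraph -> mwdigraph -> Prop :=
| Change_basis (G : mwdigraph) (O : vert G) (P Q : 'M[L]_(dim O)) :
    P *m Q = 1%:M -> Q *m P = 1%:M -> elementary G (change_basis P Q)
| Null_edge (G : mwdigraph) (x y : vert G) : elementary G (add_null_edge x y)
| Sum_edges (G : mwdigraph) (x y : vert G) (S : {set edge G}) :
    S != set0 -> (forall e, e \in S -> src e = x /\ tgt e = y) ->
    elementary G (sum_edges x y S)
| Source (G : mwdigraph) (v : vert G) :
    (forall e : edge G, tgt e != v) -> elementary G (delete_vertex v)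
| Sink (G : mwdigraph) (v : vert G) :
    (forall e : edge G, src e != v) -> elementary G (delete_vertex v)
| Hub_out (G : mwdigraph) (e : edge G) :
    src e != tgt e -> (exists f : edge G, src f = tgt e) ->
    elementary G (resolve_hub_out e)
| Hub_in (G : mwdigraph) (e : edge G) :
    src e != tgt e -> (exists f : edge G, tgt f = src e) ->
    elementary G (resolve_hub_in e).

(* Equality up to the names of the vertices and of the edges. The equations p
   and q, which follow from the others, only retype the weight. *)
Definition mw_iso (G H : mwdigraph) : Prop :=
  exists (fv : vert G -> vert H) (fe : edge G -> edge H),
  [/\ bijective fv, bijective fe,
      forall e, src (fe e) = fv (src e) /\ tgt (fe e) = fv (tgt e),
      forall v, dim (fv v) = dim v &
      forall e (p : dim (src e) = dim (src (fe e)))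
               (q : dim (tgt e) = dim (tgt (fe e))),
        wgt (fe e) = castmx (p, q) (wgt e)].

(* The intermediate graphs are matrix-weighted graphs too, hence connected. *)
Definition mw_equiv : mwgraph -> mwgraph -> Prop :=
  clos_refl_sym_trans mwgraph (fun G H => elementary G H \/ mw_iso G H).

End Graphs.

(* Main.v *)
From mathcomp Require Import all_boot all_order all_fingroup all_algebra.
From mathcomp Require Import reals complex.
Require Import Defs.

(** The reciprocal of the zeta function is det (1 - A), with A the adjacency
block matrix, so each elementary transformation has to be read as an operation
on A that does not change det (1 - A).

- Adding a null edge or summing parallel edges does not change A at all.
- A change of basis replaces A by D A D^-1, with D block diagonal.
- Let E be the block matrix whose only nonzero block is the weight u of the
  edge e from v1 to v2. Resolving the hub v2 replaces the row of v1 by itself,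
  minus u in column v2, plus u times the row of v2; that is,
  A' = A - E + E A and 1 - A' = (1 + E) (1 - A). As v1 <> v2, 1 + E is
  unitriangular for a suitable ordering of the vertices, so its determinant
  is 1. With the edges reversed, the factor 1 + E is on the right.
- A sink has a zero row in A and a source a zero column, so that 1 - A is block
  triangular, with an identity block at the deleted vertex.

The block of A at (x, y) has a type that depends on x and y, and the position of
a vertex in A depends on an enumeration of the vertices. Both get in the way as
soon as the set of vertices changes. Determinants are therefore compared after
they are written as [fdet], indexed by the finite type of pairs of a vertex x
and an index below [dim x], which knows nothing of enumerations. One statement,
[fdet_restrict_rows], covers all that is needed there: the determinant does
not change when the index type is cut down to a part outside of which the rows
are those of the identity. It gives the invariance under renaming (all indices
are kept), under deletion of a sink (those of the other vertices are kept) and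
det (1 + E) = 1 (those of v1 are kept); its transpose serves for sources.
Renaming and deletion both embed a graph as a full subgraph of another one, and
are treated together in [zeta_inv_embed]. *)

Set Implicit Arguments.
Unset Strict Implicit.
Unset Printing Implicit Defensive.

Import GRing.Theory.
Local Open Scope ring_scope.

(** * Finite sums and bijections *)

Lemma inj_surj_bij (S T : finType) (h : S -> T) :
  injective h -> (forall b, exists a, h a = b) -> bijective h.
Proof.
move=> hI hS; apply: inj_card_bij => //.
rewrite -(card_codom hI) subset_leq_card //.
by apply/subsetP => b _; have [a <-] := hS b; apply: codom_f.
Qed.

Lemma sum_option (V : nmodType) (I : finType) (F : option I -> V) :
  \sum_o F o = F None + \sum_i F (Some i).
Proof.
rewrite (bigD1 None) //=; congr (_ + _).
rewrite (reindex_omap Some id) => [|[i|]] //=.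
by apply: eq_bigl => i; rewrite eqxx.
Qed.

Lemma sum_sig (V : nmodType) (I : finType) (P : pred I) (F : I -> V) :
  \sum_(i : {i | P i}) F (val i) = \sum_(i | P i) F i.
Proof. by rewrite -(big_sub P F). Qed.

Section TagMap.
Variables (I J : finType) (g : I -> J) (dI : I -> nat) (dJ : J -> nat).
Hypothesis dE : forall i, dJ (g i) = dI i.

(** Reindexing a dependent pair along g needs a cast, as the dimensions at i and
at [g i] are only propositionally equal. *)
Definition tag_map (p : {i : I & 'I_(dI i)}) : {j : J & 'I_(dJ j)} :=
  Tagged (fun j => 'I_(dJ j)) (cast_ord (esym (dE (tag p))) (tagged p)).

Lemma tag_map_inj : injective g -> injective tag_map.
Proof.
move=> gI [i k] [j l] E.
have ij : i = j by apply: gI; apply: (congr1 tag E).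
subst j; move/eqP: E; rewrite /tag_map eq_Tagged /= => /eqP/cast_ord_inj.
by move=> ->.
Qed.

Lemma codom_tag_map (j : J) (k : 'I_(dJ j)) :
  j \in codom g -> Tagged (fun j => 'I_(dJ j)) k \in codom tag_map.
Proof.
move=> /codomP[i ij]; subst j.
apply/codomP; exists (Tagged (fun i => 'I_(dI i)) (cast_ord (dE i) k)).
by apply/eqP; rewrite /tag_map eq_Tagged /= cast_ordK.
Qed.

Lemma tag_map_bij : bijective g -> bijective tag_map.
Proof.
move=> gB; apply: inj_surj_bij => [|[j k]]; first exact/tag_map_inj/bij_inj.
have /codomP[p E] : Tagged (fun j => 'I_(dJ j)) k \in codom tag_map.
  apply: codom_tag_map; have [g' _ g'K] := gB.
  by rewrite -[j]g'K codom_f.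
by exists p; apply: esym E.
Qed.

End TagMap.

(** * Determinants indexed by a finite type *)

Section FDet.
Variable L : comNzRingType.
Implicit Types S T : finType.

(** The enumeration of T is an arbitrary choice, which [fdet_enum] shows to be
irrelevant. *)
Definition fdet T (M : T -> T -> L) : L :=
  \det (\matrix_(i, j < #|T|) M (enum_val i) (enum_val j)).

(** Two enumerations differ by a permutation matrix P, and the matrices by
conjugation with it. *)
Lemma fdet_enum T n (h : 'I_n -> T) (M : T -> T -> L) :
  bijective h -> \det (\matrix_(i, j) M (h i) (h j)) = fdet M.
Proof.
move=> hB; have := bij_eq_card hB; rewrite card_ord => nE; subst n.
have s_inj : injective (enum_rank \o h).
  by apply: inj_comp; [apply: enum_rank_inj | apply: bij_inj].
pose P := perm_mx (perm s_inj) : 'M[L]_#|T|.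
have PP : P *m P^T = 1%:M by rewrite /P tr_perm_mx -perm_mxM mulgV perm_mx1.
rewrite /fdet; set N := (N in _ = \det N).
have -> : \matrix_(i, j) M (h i) (h j) = P *m N *m P^T.
  rewrite /P tr_perm_mx -row_permE -col_permE.
  by apply/matrixP=> i j; rewrite !mxE !permE /= !enum_rankK.
by rewrite !det_mulmx mulrC mulrA [\det P^T * _]mulrC -det_mulmx PP det1 mul1r.
Qed.

Lemma fdet_tr T (M : T -> T -> L) : fdet M = fdet (fun a b => M b a).
Proof.
by rewrite /fdet -det_tr; congr (\det _); apply/matrixP=> i j; rewrite !mxE.
Qed.

Lemma eq_fdet T (M N : T -> T -> L) :
  (forall a b, M a b = N a b) -> fdet M = fdet N.
Proof. by move=> MN; congr (\det _); apply/matrixP=> i j; rewrite !mxE MN. Qed.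

Lemma fdet_id T : fdet (fun a b : T => (a == b)%:R) = 1.
Proof.
rewrite -[RHS](det1 L #|T|); congr (\det _); apply/matrixP=> i j.
by rewrite !mxE (inj_eq enum_val_inj).
Qed.

(** Listing the image of h first makes the matrix block upper triangular, with
an identity block in the lower right corner. *)
Lemma fdet_restrict_rows S T (h : S -> T) (M : T -> T -> L) :
    injective h ->
    (forall a b, a \notin codom h -> M a b = (a == b)%:R) ->
  fdet M = fdet (fun a b => M (h a) (h b)).
Proof.
move=> hI Mid; pose C := {a : T | a \notin codom h}.
pose g (k : 'I_(#|S| + #|{: C}|)) : T :=
  match split k with inl i => h (enum_val i) | inr i => val (enum_val i) end.
have gl i : g (lshift _ i) = h (enum_val i).
  by rewrite /g (unsplitK (inl _ i)).
have gr i : g (rshift _ i) = val (enum_val i).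
  by rewrite /g (unsplitK (inr _ i)).
have gB : bijective g.
  apply: inj_surj_bij => [k l|a].
    rewrite -[k]splitK -[l]splitK.
    case: (split k) => i; case: (split l) => j /=; rewrite ?gl ?gr.
    - by move/hI/enum_val_inj->.
    - by move=> E; have := valP (enum_val j); rewrite -E codom_f.
    - by move=> E; have := valP (enum_val i); rewrite E codom_f.
    - by move/val_inj/enum_val_inj->.
  have [/codomP[s ->]|aC] := boolP (a \in codom h).
    by exists (lshift _ (enum_rank s)); rewrite gl enum_rankK.
  by exists (rshift _ (enum_rank (exist _ a aC : C))); rewrite gr enum_rankK.
pose A := \matrix_(i, j) M (g i) (g j).
have Adl : dlsubmx A = 0.
  apply/matrixP=> i j; rewrite !mxE gl gr Mid ?(valP (enum_val i)) //.
  by case: eqP => // E; have := valP (enum_val i); rewrite E codom_f.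
have Adr : drsubmx A = 1%:M.
  apply/matrixP=> i j; rewrite !mxE !gr Mid ?(valP (enum_val i)) //.
  by rewrite (inj_eq val_inj) (inj_eq enum_val_inj).
rewrite -(fdet_enum M gB) -/A -[A]submxK Adl Adr det_ublock det1 mulr1.
by congr (\det _); apply/matrixP=> i j; rewrite !mxE !gl.
Qed.

Lemma fdet_restrict_cols S T (h : S -> T) (M : T -> T -> L) :
    injective h ->
    (forall a b, b \notin codom h -> M a b = (a == b)%:R) ->
  fdet M = fdet (fun a b => M (h a) (h b)).
Proof.
move=> hI Mid; rewrite [LHS]fdet_tr [RHS]fdet_tr.
by apply: (fdet_restrict_rows hI) => a b aC; rewrite Mid // eq_sym.
Qed.

End FDet.

(** * The adjacency matrix *)

Section Zeta.
Variable L : comNzRingType.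
Implicit Types G H : mwdigraph L.

Lemma wgt_at_ends G (e : edge G) : wgt_at (src e) (tgt e) e = wgt e.
Proof.
rewrite /wgt_at; case: eqP => // p; case: eqP => // q.
by rewrite (eq_irrelevance p erefl) (eq_irrelevance q erefl) castmx_id.
Qed.

Lemma wgt_at_cast G (x y : vert G) e (p : src e = x) (q : tgt e = y) :
  wgt_at x y e = castmx (congr1 _ p, congr1 _ q) (wgt e).
Proof. by case: _ / p; case: _ / q; rewrite wgt_at_ends castmx_id. Qed.

Lemma wgt_at_out G (x y : vert G) (e : edge G) :
  ~~ ((src e == x) && (tgt e == y)) -> wgt_at x y e = 0.
Proof. by rewrite /wgt_at; case: eqP => // p; case: eqP. Qed.

Lemma adjacency_blockE G (x y : vert G) :
  adjacency_block x y = \sum_e wgt_at x y e.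
Proof. by apply: big_rmcond => e; apply: wgt_at_out. Qed.

Lemma sum_wgt_at_src G (x y : vert G) :
  \sum_e wgt_at x y e = \sum_(e | src e == x) wgt_at x y e.
Proof.
by symmetry; apply: big_rmcond => e ex; rewrite wgt_at_out // (negPf ex).
Qed.

Lemma sum_wgt_at_tgt G (x y : vert G) :
  \sum_e wgt_at x y e = \sum_(e | tgt e == y) wgt_at x y e.
Proof.
by symmetry; apply: big_rmcond => e ey; rewrite wgt_at_out // (negPf ey) andbF.
Qed.

(** * Block matrices indexed by vertices *)

(** This has the form of [adjacency], so that the other block matrices can be
added to it and multiplied with it. *)
Definition vblock (V : finType) (d : V -> nat)
    (F : forall x y : V, 'M[L]_(d x, d y)) :=
  \mxblock_(i < #|V|, j < #|V|) F (enum_val i) (enum_val j).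

Lemma mul_vblock (V : finType) (d : V -> nat)
    (F F' : forall x y : V, 'M[L]_(d x, d y)) :
  vblock F *m vblock F' = vblock (fun x y => \sum_z F x z *m F' z y).
Proof.
rewrite mul_mxblock; apply: eq_mxblock => i j.
by rewrite [RHS](reindex _ (onW_bij _ (enum_val_bij V))).
Qed.

(** Every position in the block matrix is a pair of a vertex and an index in its
block. The scalar c is -1 for the zeta function and 1 for the transvections
that resolve hubs. *)
Lemma det_vblock (V : finType) (d : V -> nat)
    (F : forall x y : V, 'M[L]_(d x, d y)) (c : L) :
  \det (1%:M + c *: vblock F) =
  fdet (fun a b : {x : V & 'I_(d x)} =>
          (a == b)%:R + c * F (tag a) (tag b) (tagged a) (tagged b)).
Proof.
pose h := tag_map (fun i : 'I_#|V| => erefl (d (enum_val i))) \o tagnat.sig.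
have hB : bijective h.
  exact: bij_comp (tag_map_bij _ (enum_val_bij V)) tagnat.sig_bij.
rewrite -(fdet_enum _ hB); congr (\det _); apply/matrixP=> k l.
rewrite /vblock /mxblock !mxE (inj_eq (bij_inj hB)) /=.
by rewrite !cast_ord_id.
Qed.

Definition zeta_mx G (a b : {x : vert G & 'I_(dim x)}) : L :=
  (a == b)%:R - (\sum_e wgt_at (tag a) (tag b) e) (tagged a) (tagged b).

Lemma zeta_invE G : zeta_inv G = fdet (@zeta_mx G).
Proof.
rewrite /zeta_inv -scaleN1r (det_vblock (@adjacency_block L G)).
by apply: eq_fdet => a b; rewrite mulN1r adjacency_blockE.
Qed.

(** * Full subgraphs, renaming and deletion of vertices *)

Section Embedding.
Variables (G H : mwdigraph L).
Variables (fv : vert G -> vert H) (fe : edge G -> edge H).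
Hypotheses (fv_inj : injective fv) (fe_inj : injective fe).
Hypothesis fe_ends :
  forall e, src (fe e) = fv (src e) /\ tgt (fe e) = fv (tgt e).
Hypothesis fv_dim : forall v, dim (fv v) = dim v.
Hypothesis fe_wgt :
  forall e (p : dim (src e) = dim (src (fe e)))
    (q : dim (tgt e) = dim (tgt (fe e))), wgt (fe e) = castmx (p, q) (wgt e).
Hypothesis fe_full :
  forall e, src e \in codom fv -> tgt e \in codom fv -> e \in codom fe.

Lemma wgt_at_embed x y e i j :
  wgt_at (fv x) (fv y) (fe e)
    (cast_ord (esym (fv_dim x)) i) (cast_ord (esym (fv_dim y)) j) =
  wgt_at x y e i j.
Proof.
have [se te] := fe_ends e.
have [/andP[/eqP p /eqP q]|out] := boolP ((src e == x) && (tgt e == y)).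
  subst x y; rewrite wgt_at_ends (wgt_at_cast se te) castmxE fe_wgt.
  - by rewrite se fv_dim.
  - by rewrite te fv_dim.
  by move=> *; rewrite castmxE; congr (wgt e _ _); apply: val_inj.
rewrite !wgt_at_out ?mxE // se te.
by rewrite !(inj_eq fv_inj).
Qed.

Lemma zeta_mx_embed a b :
  zeta_mx (tag_map fv_dim a) (tag_map fv_dim b) = zeta_mx a b.
Proof.
rewrite /zeta_mx (inj_eq (tag_map_inj fv_inj)); congr (_ - _).
rewrite !summxE (bigID (mem (codom fe))) /= [X in _ + X]big1 ?addr0.
  rewrite -big_uniq /codom ?big_image /=; last first.
    by rewrite map_inj_uniq ?enum_uniq.
  by apply: eq_bigr => e _; apply: wgt_at_embed.
move=> e eC; rewrite wgt_at_out ?mxE //.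
by apply: contra eC => /andP[/eqP se /eqP te]; rewrite fe_full ?se ?te ?codom_f.
Qed.

(** If no edge starts outside of the subgraph, the rows of the other vertices
are those of the identity; if no edge ends there, the columns are. *)
Lemma zeta_inv_embed :
    (forall e : edge H, src e \in codom fv) \/
    (forall e : edge H, tgt e \in codom fv) ->
  zeta_inv H = zeta_inv G.
Proof.
pose h := tag_map fv_dim.
have hI : injective h by apply: tag_map_inj.
have tC (a : {x : vert H & 'I_(dim x)}) :
    a \notin codom h -> tag a \notin codom fv.
  by case: a => x i; apply: contra => /codom_tag_map; apply.
rewrite !zeta_invE => -[srcC|tgtC].
  rewrite (fdet_restrict_rows hI).
    by apply: eq_fdet => a b; apply: zeta_mx_embed.
  move=> a b /tC aC; rewrite /zeta_mx big1 ?mxE ?subr0 // => e _.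
  by apply: wgt_at_out; apply: contra aC => /andP[/eqP <-].
rewrite (fdet_restrict_cols hI).
  by apply: eq_fdet => a b; apply: zeta_mx_embed.
move=> a b /tC bC; rewrite /zeta_mx big1 ?mxE ?subr0 // => e _.
by apply: wgt_at_out; apply: contra bC => /andP[_ /eqP <-].
Qed.

End Embedding.

Lemma zeta_inv_iso G H : mw_iso G H -> zeta_inv G = zeta_inv H.
Proof.
move=> [fv [fe [fvB feB ends dimE wgtE]]]; symmetry.
have inC (S T : finType) (f : S -> T) x : bijective f -> x \in codom f.
  by case=> g _ gK; rewrite -[x]gK codom_f.
apply: (zeta_inv_embed (bij_inj fvB) (bij_inj feB) ends dimE wgtE) => [e _ _|].
  exact: inC.
by left=> e; apply: inC.
Qed.

Lemma zeta_inv_delete G (v : vert G) :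
    (forall e : edge G, tgt e != v) \/ (forall e : edge G, src e != v) ->
  zeta_inv (delete_vertex v) = zeta_inv G.
Proof.
move=> vE; symmetry.
pose fv : vert (delete_vertex v) -> vert G := val.
pose fe : edge (delete_vertex v) -> edge G := val.
have fvC x : (x \in codom fv) = (x != v).
  apply/codomP/idP => [[y ->]|xv]; first exact: (valP y).
  by exists (exist _ x xv).
apply: (@zeta_inv_embed (delete_vertex v) G fv fe) => //.
- exact: val_inj.
- exact: val_inj.
- move=> e p q; rewrite (eq_irrelevance p erefl) (eq_irrelevance q erefl).
  by rewrite castmx_id.
- move=> e; rewrite !fvC => sv tv; apply/codomP.
  by exists (exist _ e (introT andP (conj sv tv))).
by case: vE => vE; [right|left] => e; rewrite fvC.
Qed.

(** * Transformations that keep the vertices *)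

(** Stated for a graph that shares its vertices and dimensions with G
definitionally, so that the weights of both have the same type. *)
Lemma eq_zeta_inv G (E : finType) (s t : E -> vert G) w :
  let G' := @MWDigraph L (vert G) E s t (@dim L G) w in
  (forall x y : vert G, \sum_e @wgt_at L G' x y e = \sum_e wgt_at x y e) ->
  zeta_inv G' = zeta_inv G.
Proof.
move=> G' E_; rewrite !zeta_invE; apply: eq_fdet => a b.
by rewrite /zeta_mx; congr (_ - fun_of_matrix _ _ _); apply: E_.
Qed.

Lemma zeta_inv_null G (x y : vert G) :
  zeta_inv (add_null_edge x y) = zeta_inv G.
Proof.
apply: eq_zeta_inv => u v.
rewrite sum_option [X in X + _](_ : _ = 0) ?add0r //.
pose o : edge (add_null_edge x y) := None.
have [/andP[/eqP<- /eqP<-]|/wgt_at_out//] :=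
  boolP ((src o == u) && (tgt o == v)).
exact: (wgt_at_ends o).
Qed.

Lemma zeta_inv_sum G (x y : vert G) (S : {set edge G}) :
    (forall e, e \in S -> src e = x /\ tgt e = y) ->
  zeta_inv (sum_edges x y S) = zeta_inv G.
Proof.
move=> SE; apply: eq_zeta_inv => u v.
rewrite sum_option [RHS](bigID (mem S)) /=; congr (_ + _).
  pose o : edge (sum_edges x y S) := None.
  have [/andP[/eqP<- /eqP<-]|out] := boolP ((src o == u) && (tgt o == v)).
    exact: (wgt_at_ends o).
  rewrite [LHS](wgt_at_out out) big1 // => e /SE [se te]; apply: wgt_at_out.
  by rewrite se te.
exact: (sum_sig (fun e => e \notin S) (fun e => wgt_at u v e)).
Qed.

(** The adjacency matrix is conjugated by the block diagonal matrix with P at O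
and identities elsewhere. *)
Lemma zeta_inv_basis G (O : vert G) (P Q : 'M[L]_(dim O)) :
  P *m Q = 1%:M -> zeta_inv (change_basis P Q) = zeta_inv G.
Proof.
move=> PQ.
pose D (R : 'M[L]_(dim O)) := \mxdiag_(i < #|vert G|) basis_at R (enum_val i).
have DPQ : D P *m D Q = 1%:M.
  rewrite /D mul_mxdiag_mxblock -(@mxdiagZ _ _ (fun i => dim (enum_val i))).
  apply: eq_mxblock => i j; case: eqP => [ij|_]; last by rewrite mulmx0.
  subst j; rewrite !conform_mx_id; move: (enum_val i) => x.
  have [<-|Ox] := eqVneq O x; first by rewrite /basis_at !dfwith_in.
  by rewrite /basis_at !dfwith_out // mulmx1.
have AE : adjacency (change_basis P Q) = D P *m adjacency G *m D Q.
  rewrite mul_mxdiag_mxblock mul_mxblock_mxdiag; apply: eq_mxblock => k l.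
  rewrite !adjacency_blockE mulmx_sumr mulmx_suml; apply: eq_bigr => e _.
  move: (enum_val k) (enum_val l) => x y.
  have [/andP[/eqP<- /eqP<-]|out] :=
    boolP ((@src L G e == x) && (@tgt L G e == y)).
    rewrite [in RHS]wgt_at_ends; exact: (@wgt_at_ends (change_basis P Q) e).
  rewrite [in RHS](wgt_at_out out) mulmx0 mul0mx.
  exact: (@wgt_at_out (change_basis P Q)).
have -> : zeta_inv (change_basis P Q) =
          \det (D P *m (1%:M - adjacency G) *m D Q).
  by rewrite mulmxBr mulmxBl mulmx1 DPQ -AE.
by rewrite !det_mulmx mulrAC -det_mulmx DPQ det1 mul1r.
Qed.

(** * Resolution of hubs *)

Section Hub.
Variables (G : mwdigraph L) (e : edge G).
Hypothesis e_noloop : src e != tgt e.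

Definition edge_mx := vblock (fun x y : vert G => wgt_at x y e).

(** Only the rows of [src e] in 1 + E differ from those of the identity. On them
E lives in the columns of [tgt e], another vertex, so that restricting the
indices to [src e] leaves an identity matrix. *)
Lemma det_transvection : \det (1%:M + edge_mx) = 1.
Proof.
rewrite -[edge_mx]scale1r (det_vblock (fun x y => wgt_at x y e)).
pose T := {x : vert G & 'I_(dim x)}.
pose h (i : 'I_(dim (src e))) : T := Tagged (fun x => 'I_(dim x)) i.
have hI : injective h.
  by move=> i j /eqP; rewrite /h eq_Tagged => /eqP.
rewrite (fdet_restrict_rows hI) => [|[x i] b aC].
  rewrite -[RHS](@fdet_id L 'I_(dim (src e))); apply: eq_fdet => i j.
  rewrite (inj_eq hI) /= wgt_at_out ?mxE ?mulr0 ?addr0 //.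
  by rewrite eqxx eq_sym.
rewrite wgt_at_out ?mxE ?mulr0 ?addr0 //=; apply: contra aC => /andP[/eqP E _].
by subst x; apply: codom_f.
Qed.

(** The term E A collects the new edges: the row of [tgt e] in A is the sum over
the edges f that start there, and each contributes the product of the weights
of e and f. *)
Lemma resolve_hub_out_mx :
  adjacency (resolve_hub_out e) =
  adjacency G - edge_mx + edge_mx *m adjacency G.
Proof.
have blockE (x y : vert G) :
    @adjacency_block L (resolve_hub_out e) x y =
    adjacency_block x y - wgt_at x y e +
      \sum_z wgt_at x z e *m adjacency_block z y.
  rewrite !adjacency_blockE big_sumType /=.
  rewrite (sum_sig (fun e' => e' != e) (fun e' => wgt_at x y e')).
  congr (_ + _).
    by rewrite [in RHS](bigD1 e) //= [RHS]addrC addKr.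
  rewrite [RHS](bigD1 (tgt e)) //= [X in _ + X]big1 ?addr0; last first.
    move=> z zt; rewrite wgt_at_out ?mul0mx //.
    by rewrite [tgt e == z]eq_sym (negPf zt) andbF.
  rewrite adjacency_blockE sum_wgt_at_src mulmx_sumr.
  rewrite -(sum_sig (fun f => src f == tgt e)
              (fun f => wgt_at x (tgt e) e *m wgt_at (tgt e) y f)).
  apply: eq_bigr => f _.
  set G' := resolve_hub_out e; pose d : edge G' := inr f.
  have [/andP[/eqP<- /eqP<-]|out] := boolP ((src d == x) && (tgt d == y)).
    rewrite [RHS]/= wgt_at_ends; exact: (wgt_at_ends d).
  rewrite [LHS](wgt_at_out out).
  move: out; rewrite /= negb_and => /orP[sx|ty].
    by rewrite wgt_at_out ?mul0mx // (negPf sx).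
  by rewrite [wgt_at _ _ (val f)]wgt_at_out ?mulmx0 // (negPf ty) andbF.
rewrite mul_vblock -mxblockB -mxblockD; apply: eq_mxblock => i j.
exact: blockE.
Qed.

Lemma resolve_hub_in_mx :
  adjacency (resolve_hub_in e) =
  adjacency G - edge_mx + adjacency G *m edge_mx.
Proof.
have blockE (x y : vert G) :
    @adjacency_block L (resolve_hub_in e) x y =
    adjacency_block x y - wgt_at x y e +
      \sum_z adjacency_block x z *m wgt_at z y e.
  rewrite !adjacency_blockE big_sumType /=.
  rewrite (sum_sig (fun e' => e' != e) (fun e' => wgt_at x y e')).
  congr (_ + _).
    by rewrite [in RHS](bigD1 e) //= [RHS]addrC addKr.
  rewrite [RHS](bigD1 (src e)) //= [X in _ + X]big1 ?addr0; last first.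
    by move=> z zt; rewrite wgt_at_out ?mulmx0 // eq_sym (negPf zt).
  rewrite adjacency_blockE sum_wgt_at_tgt mulmx_suml.
  rewrite -(sum_sig (fun f => tgt f == src e)
              (fun f => wgt_at x (src e) f *m wgt_at (src e) y e)).
  apply: eq_bigr => f _.
  set G' := resolve_hub_in e; pose d : edge G' := inr f.
  have [/andP[/eqP<- /eqP<-]|out] := boolP ((src d == x) && (tgt d == y)).
    rewrite [RHS]/= [in RHS]wgt_at_ends; exact: (wgt_at_ends d).
  rewrite [LHS](wgt_at_out out).
  move: out; rewrite /= negb_and => /orP[sx|ty].
    by rewrite wgt_at_out ?mul0mx // (negPf sx).
  by rewrite [wgt_at _ _ e]wgt_at_out ?mulmx0 // (negPf ty) andbF.
rewrite mul_vblock -mxblockB -mxblockD; apply: eq_mxblock => i j.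
exact: blockE.
Qed.

Lemma zeta_inv_hub_out : zeta_inv (resolve_hub_out e) = zeta_inv G.
Proof.
have -> : zeta_inv (resolve_hub_out e) =
          \det ((1%:M + edge_mx) *m (1%:M - adjacency G)).
  rewrite /zeta_inv resolve_hub_out_mx; congr (\det _).
  rewrite mulmxBr mulmx1 mulmxDl mul1mx !opprD opprK !addrA.
  by rewrite [_ + edge_mx]addrAC.
by rewrite det_mulmx det_transvection mul1r.
Qed.

Lemma zeta_inv_hub_in : zeta_inv (resolve_hub_in e) = zeta_inv G.
Proof.
have -> : zeta_inv (resolve_hub_in e) =
          \det ((1%:M - adjacency G) *m (1%:M + edge_mx)).
  rewrite /zeta_inv resolve_hub_in_mx; congr (\det _).
  by rewrite mulmxDr mulmx1 mulmxBl mul1mx !opprD opprK !addrA.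
by rewrite det_mulmx det_transvection mulr1.
Qed.

End Hub.

Lemma zeta_inv_elementary G H : elementary G H -> zeta_inv G = zeta_inv H.
Proof.
case=> {G H}.
- by move=> G O P Q PQ _; rewrite zeta_inv_basis.
- by move=> G x y; rewrite zeta_inv_null.
- by move=> G x y S _ Sxy; rewrite zeta_inv_sum.
- by move=> G v vE; rewrite zeta_inv_delete //; left.
- by move=> G v vE; rewrite zeta_inv_delete //; right.
- by move=> G e e_noloop _; rewrite zeta_inv_hub_out.
- by move=> G e e_noloop _; rewrite zeta_inv_hub_in.
Qed.

End Zeta.

Theorem theorem1p1 (R : realType) (G G' : mwgraph (laurent (complex R))) :
  mw_equiv G G' -> zeta_inv G = zeta_inv G'.
Proof.
elim=> {G G'} [G H [GH|GH]|G|G H _ <-|G H K _ -> _ ->] //.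
- exact: zeta_inv_elementary.
- exact: zeta_inv_iso.
Qed.
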